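(* Let $p$ be a prime, let $\alpha,l,n\in\{0,1,2,\ldots\}$ and $r\in\mathbb{Z}$. Let $r_*$ be the least nonnegative residue of $r$ modulo $p^\alpha$, let $n_*=r_*+\{n-r\}_{p^\alpha}$ where $\{n-r\}_{p^\alpha}$ is the least nonnegative residue of $n-r$ modulo $p^\alpha$, and set $$m=\frac{n-n_*}{p^\alpha}=\left\lfloor\frac{r}{p^\alpha}\right\rfloor+\left\lfloor\frac{n-r}{p^\alpha}\right\rfloor.$$ Suppose that $l\geqslant m>0$ and $$l\equiv m\pmod{(p-1)p^{\lfloor\log_p m\rfloor-\delta_p(\lfloor r/p^\alpha\rfloor,\,m)}},$$ where for $a\in\mathbb{Z}$, $\delta_p(a,m)=1$ if $p\mid a$ and $\log_p m$ is a positive integer, and $\delta_p(a,m)=0$ otherwise. Then $$\frac{1}{\lfloor n/p^\alpha\rfloor!\binom{n_*}{r_*}}\sum_{k\equiv r\ (\mathrm{mod}\ p^\alpha)}(-1)^k\binom{n}{k}\left(\frac{k-r}{p^\alpha}\right)^l\equiv(-1)^{l+r_*}\pmod p.$$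
   Context: The sum runs over all integers $k\equiv r\pmod{p^\alpha}$, with $\binom nk=0$ unless $0\le k\le n$; the convention $0^0=1$ is used. The left-hand side is a rational number, and the congruence modulo $p$ means that its difference with $(-1)^{l+r_*}$ is a rational number lying in $p\mathbb{Z}_p$ (i.e. the left side is a $p$-adic integer congruent to $(-1)^{l+r_*}$ modulo $p$). *)

(* Defs.v *)
From HB Require Import structures.
From mathcomp Require Import all_boot all_order all_algebra.
From mathcomp Require Import ring.

Set Implicit Arguments.
Unset Strict Implicit.
Unset Printing Implicit Defensive.

Import Order.TTheory GRing.Theory Num.Theory.
Local Open Scope ring_scope.

Definition rstar (p alpha : nat) (r : int) : nat :=
  `|(r %% (p ^ alpha)%N%:Z)%Z|%N.

Definition nstar (p alpha n : nat) (r : int) : nat :=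
  (rstar p alpha r + `|((n%:Z - r) %% (p ^ alpha)%N%:Z)%Z|)%N.

(* The division is exact and this is the sum of floors of r / p^alpha and
   (n - r) / p^alpha: see [mquot_exact] and [mquot_floors]. It can be -1. *)
Definition mquot (p alpha n : nat) (r : int) : int :=
  ((n%:Z - (nstar p alpha n r)%:Z) %/ (p ^ alpha)%N%:Z)%Z.

(* The bound on k loses nothing: see [log_pos_intP]. *)
Definition log_pos_int (p m : nat) : bool :=
  [exists k : 'I_m, (0 < k)%N && (m == p ^ k)%N].

Definition delta (p : nat) (a : int) (m : nat) : nat :=
  if (p%:Z %| a)%Z && log_pos_int p m then 1%N else 0%N.

(* The rationals lying in Z_p; [denq] is the denominator in lowest terms. *)
Definition in_Zp (p : nat) (x : rat) : Prop := ~~ (p%:Z %| denq x)%Z.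

Definition congr_Zp (p : nat) (x y : rat) : Prop :=
  exists2 z : rat, in_Zp p z & x - y = p%:R * z.

Lemma log_pos_intP (p m : nat) : prime p ->
  reflect (exists2 k, (0 < k)%N & m = (p ^ k)%N) (log_pos_int p m).
Proof.
move=> p_pr; apply: (iffP existsP) => [[k /andP[k0 /eqP mE]]|[k k0 mE]].
  by exists (val k).
have km : (k < m)%N by rewrite mE ltn_expl // prime_gt1.
by exists (Ordinal km); rewrite /= k0 mE eqxx.
Qed.

Lemma mquot_sub (p alpha n : nat) (r : int) : prime p ->
  n%:Z - (nstar p alpha n r)%:Z =
  ((r %/ (p ^ alpha)%N%:Z)%Z + ((n%:Z - r) %/ (p ^ alpha)%N%:Z)%Z)
    * (p ^ alpha)%N%:Z.
Proof.
move=> p_pr; rewrite /nstar /rstar; set q := (p ^ alpha)%N%:Z.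
have q0 : q != 0 by rewrite eqz_nat -lt0n expn_gt0 prime_gt0.
rewrite PoszD !gez0_abs ?modz_ge0 // /modz; ring.
Qed.

Lemma mquot_floors (p alpha n : nat) (r : int) : prime p ->
  mquot p alpha n r =
  (r %/ (p ^ alpha)%N%:Z)%Z + ((n%:Z - r) %/ (p ^ alpha)%N%:Z)%Z.
Proof.
move=> p_pr; rewrite /mquot mquot_sub // mulzK //.
by rewrite eqz_nat -lt0n expn_gt0 prime_gt0.
Qed.

Lemma mquot_exact (p alpha n : nat) (r : int) : prime p ->
  mquot p alpha n r * (p ^ alpha)%N%:Z = n%:Z - (nstar p alpha n r)%:Z.
Proof. by move=> p_pr; rewrite mquot_floors // mquot_sub. Qed.

(* Main.v *)
Require Import Defs.
From HB Require Import structures.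
From mathcomp Require Import all_boot all_order all_algebra.
From mathcomp Require Import finfield ring zify.

Set Implicit Arguments.
Unset Strict Implicit.
Unset Printing Implicit Defensive.

Import Order.TTheory GRing.Theory Num.Theory.
Local Open Scope ring_scope.

(** Write [q = p ^ alpha], [a] for the floor of [r / q], and [k = r' + q j].
    Then [(k - r) / q = j - a], and [(-1) ^ k 'C(n, k)] is the product of
    [(-1) ^ j 'C(m, j) g(j)] with [(-1) ^ r' 'C(n', r') (n %/ q)! / m!] and a
    constant congruent to [1] modulo [p], where [g] is on [0, ..., m] a
    polynomial function with [p]-integral coefficients, congruent to [1]. For
    [alpha = 1] and [n' = 0] this comes from expanding
    [(1 - X) ^ (p m) = (1 - X ^ p + p h) ^ m], since [p ^ k / k!] is divisible
    by [p] for [k > 0]. The functional [sum_j (-1) ^ j 'C(m, j) f(j) / m!]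
    maps [p]-integral polynomials to [p]-integral numbers, so modulo [p] only
    [f(j) = (j - a) ^ l] matters. Finally, over F_p the hypothesis on [l] makes
    [prod_(i <= m) (X - i)], a divisor of a power of [X ^ p - X], divide
    [(X - a) ^ l - (X - a) ^ m], and the functional takes the value [(-1) ^ m]
    on [(X - a) ^ m]. *)

(** * The ring of [p]-integral rationals *)

(** The form of [in_Zp] that can carry a subring structure, so that the [rpred] lemmas apply;
    [Zloc_in_Zp] returns to the form used in the theorem. *)
Definition Zloc (p : nat) : {pred rat} := fun x => coprime p `|denq x|.

(** The reduced denominator is prime to the numerator, so by Gauss it divides every other
    denominator. Closure properties can then be checked on unreduced denominators. *)
Lemma ZlocP (p : nat) (x : rat) :
  reflect (exists2 b : nat, coprime p b & x * b%:R \is a Num.int)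
          (x \in Zloc p).
Proof.
apply: (iffP idP) => [px|[b pb /intrP[z xb]]].
  exists `|denq x|%N => //; rewrite natr_absz normr_denq.
  by rewrite -numqE intr_int.
have : (denq x %| b%:Z)%Z.
  rewrite -(@Gauss_dvdzr (denq x) (numq x)); last first.
    by rewrite coprimezE coprime_sym coprime_num_den.
  apply/dvdzP; exists z; apply: (@intr_inj rat).
  by rewrite !rmorphM /= -xb numqE -pmulrn mulrAC.
by rewrite dvdzE => /coprime_dvdr; apply.
Qed.

Fact Zloc_subring_closed p : subring_closed (Zloc p).
Proof.
split=> [|x y /ZlocP[b pb xb] /ZlocP[c pc yc]|].
- by apply/ZlocP; exists 1%N; rewrite ?coprimen1 ?mulr1 ?rpred1.
- apply/ZlocP; exists (b * c)%N; first by rewrite coprimeMr pb.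
  have -> : (x - y) * (b * c)%:R = (x * b%:R) * c%:R - (y * c%:R) * b%:R :> rat.
    by rewrite natrM; ring.
  by rewrite rpredB // rpredM // rpred_nat.
move=> x y /ZlocP[b pb xb] /ZlocP[c pc yc].
apply/ZlocP; exists (b * c)%N; first by rewrite coprimeMr pb.
have -> : x * y * (b * c)%:R = (x * b%:R) * (y * c%:R) :> rat.
  by rewrite natrM; ring.
by rewrite rpredM.
Qed.

HB.instance Definition _ p :=
  GRing.isSubringClosed.Build rat (Zloc p) (Zloc_subring_closed p).

Lemma Zloc_in_Zp (p : nat) (x : rat) : prime p -> x \in Zloc p -> in_Zp p x.
Proof.
by move=> p_pr; rewrite /in_Zp -topredE /= /Zloc prime_coprime // dvdzE.
Qed.

Lemma Zloc_natV (p b : nat) : coprime p b -> b%:R^-1 \in Zloc p.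
Proof.
move=> pb; apply/ZlocP; exists b => //.
have [->|b0] := eqVneq (b%:R : rat) 0; first by rewrite mulr0 rpred0.
by rewrite mulVf // rpred1.
Qed.

(** If [x = z / b], the inverse is [b / (b + p z)], and [b + p z] is prime to [p] because [b] is. *)
Lemma Zloc_1pV (p : nat) (x : rat) :
  x \in Zloc p -> (1 + p%:R * x)^-1 \in Zloc p.
Proof.
case/ZlocP=> b pb /intrP[z xb].
have [->|x0] := eqVneq (1 + p%:R * x) 0; first by rewrite invr0 rpred0.
have E : (b%:Z + p%:Z * z)%:~R = (1 + p%:R * x) * b%:R :> rat.
  by rewrite rmorphD rmorphM /= -xb -!pmulrn; ring.
apply/ZlocP; exists (absz (b%:Z + p%:Z * z)).
  by rewrite -[coprime _ _]/(coprimez p%:Z _) /coprimez addrC mulrC gcdzMDl.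
rewrite natr_absz intr_norm E normrM mulrC.
rewrite [`|b%:R|]ger0_norm // mulrAC.
have [_|_] := ger0P (1 + p%:R * x); rewrite ?mulNr mulfV //.
  by rewrite mul1r rpred_nat.
by rewrite mul1r rpredN rpred_nat.
Qed.

Lemma Zloc_1p_neq0 (p : nat) (x : rat) :
  prime p -> x \in Zloc p -> 1 + p%:R * x != 0.
Proof.
move=> p_pr /ZlocP[b pb /intrP[z xb]]; apply/eqP => x0.
have : (p%:Z %| b%:Z)%Z.
  apply/dvdzP; exists (- z); apply: (@intr_inj rat).
  apply/eqP; rewrite mulNr rmorphN rmorphM /= -xb -!pmulrn -subr_eq0 opprK.
  have -> : b%:R + x * b%:R * p%:R = (1 + p%:R * x) * b%:R :> rat by ring.
  by rewrite x0 mul0r.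
by rewrite dvdzE /=; move: pb; rewrite prime_coprime // => /negP.
Qed.

(** * Valuations of factorials and quotients *)

Lemma logn_fact_lt p n : prime p -> (0 < n)%N -> (logn p n`! < n)%N.
Proof.
move=> p_pr n0; rewrite logn_fact //.
(* In Legendre's formula, what is left of [n] after [K] divisions by [p] pays for the later terms;
   the maximum with 1 makes the final bound strict. *)
suff H K : (\sum_(1 <= k < K.+1) n %/ p ^ k + maxn 1 (n %/ p ^ K) <= n)%N.
  by apply: leq_trans (H n); rewrite -addn1 leq_add2l leq_maxl.
elim: K => [|K IH]; first by rewrite big_geq // expn0 divn1; lia.
apply: leq_trans IH; rewrite big_nat_recr //= -addnA leq_add2l expnSr divnMA.
move: (n %/ p ^ K)%N => x; have := leq_trunc_div x p; have := prime_gt1 p_pr.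
move: (x %/ p)%N => y; nia.
Qed.

Lemma Zloc_exp_factS (p k : nat) :
  prime p -> p%:R ^+ k / (k.+1)`!%:R \in Zloc p.
Proof.
move=> p_pr; have p0 : p%:R != 0 :> rat by rewrite pnatr_eq0 -lt0n prime_gt0.
have [u /= pu kE] := pfactor_coprime p_pr (fact_gt0 k.+1).
rewrite kE natrM natrX invfM mulrCA.
rewrite rpredM ?Zloc_natV // -expfB_cond ?rpredX ?rpred_nat //.
by rewrite (negPf p0) /= -ltnS logn_fact_lt.
Qed.

Lemma Zloc_exp_fact (p k : nat) : prime p -> p%:R ^+ k / k`!%:R \in Zloc p.
Proof.
case: k => [|k] p_pr; first by rewrite fact0 divr1 rpred1.
by rewrite exprS -mulrA rpredM ?rpred_nat ?Zloc_exp_factS.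
Qed.

(** The valuation of [t] is below [alpha], so at least one factor [p] survives in the quotient. *)
Lemma Zloc_ratio (p alpha t : nat) : prime p -> ~~ (p ^ alpha %| t)%N ->
  exists2 z, z \in Zloc p & (p ^ alpha)%:R / t%:R = p%:R * z.
Proof.
move=> p_pr qt; have p0 : p%:R != 0 :> rat by rewrite pnatr_eq0 -lt0n prime_gt0.
have t0 : (0 < t)%N by case: t qt => //; rewrite dvdn0.
have [u /= pu tE] := pfactor_coprime p_pr t0.
have va : (logn p t < alpha)%N.
  by rewrite ltnNge -pfactor_dvdn.
exists (p%:R ^+ (alpha - (logn p t).+1) / u%:R).
  by rewrite rpredM ?Zloc_natV // rpredX // rpred_nat.
rewrite [RHS]mulrA -exprS -subSn // subSS [in LHS]tE natrM !natrX invfM.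
rewrite mulrCA mulrC; congr (_ / _).
by rewrite -expfB_cond // (negPf p0) /= ltnW.
Qed.

(** * Alternating binomial sums *)

(** This is [(-1) ^ m] times the [m]-th forward difference of [f] at 0. *)
Definition altsum (m : nat) (f : nat -> rat) : rat :=
  \sum_(j < m.+1) (-1) ^+ j * 'C(m, j)%:R * f j.

Lemma eq_altsum m (f g : nat -> rat) :
  (forall j, (j <= m)%N -> f j = g j) -> altsum m f = altsum m g.
Proof. by move=> fg; apply: eq_bigr => j _; rewrite fg // -ltnS. Qed.

Lemma altsumD m (f g : nat -> rat) :
  altsum m (fun j => f j + g j) = altsum m f + altsum m g.
Proof.
by rewrite /altsum -big_split; apply: eq_bigr => j _; rewrite mulrDr.
Qed.

Lemma altsumZ m c (f : nat -> rat) :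
  altsum m (fun j => c * f j) = c * altsum m f.
Proof. by rewrite /altsum mulr_sumr; apply: eq_bigr => j _; rewrite mulrCA. Qed.

Lemma altsum_cst m c : altsum m.+1 (fun=> c) = 0.
Proof.
rewrite /altsum -mulr_suml.
have -> : \sum_(j < m.+2) (-1) ^+ j * 'C(m.+1, j)%:R = (1 - 1) ^+ m.+1 :> rat.
  by rewrite exprDn; apply: eq_bigr => j _; rewrite expr1n mul1r mulr_natr.
by rewrite subrr expr0n mul0r.
Qed.

Lemma altsum_mulX m (f : nat -> rat) :
  altsum m.+1 (fun j => f j * j%:R) = - m.+1%:R * altsum m (fun j => f j.+1).
Proof.
rewrite /altsum big_ord_recl /= !mulr0 add0r mulr_sumr.
apply: eq_bigr => j _; rewrite /bump leq0n add1n exprS.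
have := congr1 (fun i => i%:R : rat) (mul_bin_diag m.+1 j); rewrite !natrM /=.
move=> E; transitivity (- (-1) ^+ j * (j.+1%:R * 'C(m.+1, j.+1)%:R) * f j.+1).
  by ring.
by rewrite -E; ring.
Qed.

Lemma polyX_split (P : {poly rat}) : P = drop_poly 1 P * 'X + (P`_0)%:P.
Proof.
apply/polyP=> -[|i]; rewrite coefD coefMX coefC ?add0r //=.
by rewrite coef_drop_poly addn1 addr0.
Qed.

(** This is [(P(X + 1) - P(0)) / (X + 1)]. *)
Definition shift_quot (P : {poly rat}) : {poly rat} :=
  drop_poly 1 P \Po ('X + 1%:P).

(** The constant [P(0)] is killed, and the rest is a multiple of [X], to which the absorption
    identity of [altsum_mulX] applies. The factor [m.+1] that comes out matches the one in [m.+1]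
    factorial. *)
Lemma altsum_recl m (P : {poly rat}) :
  altsum m.+1 (fun j => P.[j%:R]) =
  - m.+1%:R * altsum m (fun j => (shift_quot P).[j%:R]).
Proof.
rewrite (eq_altsum (g := fun j => P`_0 + (drop_poly 1 P).[j%:R] * j%:R)).
  rewrite altsumD altsum_cst add0r altsum_mulX; congr (_ * _).
  apply: eq_altsum => j _.
  by rewrite horner_comp hornerD hornerX hornerC -natr1.
by move=> j _; rewrite {1}[P]polyX_split hornerD hornerC hornerMX addrC.
Qed.

Lemma altsum0 (f : nat -> rat) : altsum 0 f = f 0%N.
Proof. by rewrite /altsum big_ord1 !mul1r. Qed.

(** Each step of [altsum_recl] releases one factor of the factorial, and [shift_quot] keeps the
    coefficients [p]-integral. *)
Lemma altsum_Zloc p m (P : {poly rat}) : P \is a polyOver (Zloc p) ->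
  altsum m (fun j => P.[j%:R]) / m`!%:R \in Zloc p.
Proof.
elim: m P => [|m IH] P PZ.
  by rewrite altsum0 fact0 divr1 rpred_horner // rpred0.
have m0 : m.+1%:R != 0 :> rat by rewrite pnatr_eq0.
rewrite altsum_recl factS natrM invfM !mulNr mulrACA divff // mul1r rpredN.
apply: IH.
apply: polyOver_comp; last by rewrite rpredD ?polyOverX ?polyOverC ?rpred1.
by apply/polyOverP=> i; rewrite coef_drop_poly (polyOverP PZ).
Qed.

(** [shift_quot] lowers the degree by one and preserves the top coefficient, so [m] steps of
    [altsum_recl] end in a constant. *)
Lemma altsum_lead m (P : {poly rat}) : (size P <= m.+1)%N ->
  altsum m (fun j => P.[j%:R]) = (-1) ^+ m * m`!%:R * P`_m.
Proof.
elim: m P => [|m IH] P sP.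
  by rewrite altsum0 fact0 !mul1r horner_coef0.
have sQ : (size (drop_poly 1 P) <= m.+1)%N by rewrite size_drop_poly leq_subLR.
have sXQ : size (shift_quot P) = size (drop_poly 1 P).
  by rewrite size_comp_poly2 // size_XaddC.
rewrite altsum_recl IH ?sXQ //.
have -> : (shift_quot P)`_m = P`_m.+1.
  rewrite -addn1 -coef_drop_poly.
  move: sQ; rewrite leq_eqVlt => /orP[/eqP sQ|sQ]; last first.
    by rewrite !nth_default ?sXQ.
  have := lead_coef_comp (drop_poly 1 P) (q := 'X + 1%:P).
  rewrite size_XaddC => /(_ isT); rewrite lead_coefXaddC expr1n mulr1.
  by rewrite !lead_coefE -/(shift_quot P) sXQ sQ.
by rewrite factS natrM exprS; ring.
Qed.

(** * Functions that are polynomial up to a small error *)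

(* The error term [p ^ m * e] is harmless because [p ^ m / m!] is [p]-integral;
   it makes the functions congruent to [1] closed under inversion. *)
Definition zfun (p m : nat) (f : nat -> rat) : Prop :=
  exists2 P : {poly rat}, P \is a polyOver (Zloc p) &
  forall j, (j <= m)%N ->
    exists2 e, e \in Zloc p & f j = P.[j%:R] + p%:R ^+ m * e.

Definition zone (p m : nat) (f : nat -> rat) : Prop :=
  exists2 g, zfun p m g & forall j, (j <= m)%N -> f j = 1 + p%:R * g j.

Section Zfun.
Variables p m : nat.
Implicit Types f g : nat -> rat.

Lemma eq_zfun f g : (forall j, (j <= m)%N -> f j = g j) ->
  zfun p m f -> zfun p m g.
Proof.
by move=> fg [P PZ fP]; exists P => // j jm; rewrite -fg //; apply: fP.
Qed.

Lemma zfun_poly (P : {poly rat}) : P \is a polyOver (Zloc p) ->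
  zfun p m (fun j => P.[j%:R]).
Proof.
by move=> PZ; exists P => // j _; exists 0; rewrite ?rpred0 // mulr0 addr0.
Qed.

Lemma zfun_err f : (forall j, (j <= m)%N -> f j \in Zloc p) ->
  zfun p m (fun j => p%:R ^+ m * f j).
Proof.
move=> fZ; exists 0 => [|j jm]; first exact: rpred0.
by exists (f j); rewrite ?fZ // horner0 add0r.
Qed.

Lemma zfun_Zloc f j : zfun p m f -> (j <= m)%N -> f j \in Zloc p.
Proof.
case=> P PZ fP /fP[e eZ ->].
by rewrite rpredD ?rpredM ?rpredX ?rpred_nat ?rpred_horner ?rpred_nat.
Qed.

Lemma zfunD f g : zfun p m f -> zfun p m g -> zfun p m (fun j => f j + g j).
Proof.
move=> [P PZ fP] [Q QZ gQ]; exists (P + Q) => [|j jm]; first exact: rpredD.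
have [[e eZ ->] [e' eZ' ->]] := (fP j jm, gQ j jm).
by exists (e + e'); rewrite ?rpredD // hornerD; ring.
Qed.

Lemma zfunM f g : zfun p m f -> zfun p m g -> zfun p m (fun j => f j * g j).
Proof.
move=> [P PZ fP] [Q QZ gQ]; exists (P * Q) => [|j jm]; first exact: rpredM.
have [[e eZ ->] [e' eZ' ->]] := (fP j jm, gQ j jm).
exists (P.[j%:R] * e' + Q.[j%:R] * e + p%:R ^+ m * e * e').
  by rewrite !rpredD ?rpredM ?rpredX ?rpred_nat // ?rpred_horner ?rpred_nat.
by rewrite hornerM; ring.
Qed.

Lemma zfun_cst c : c \in Zloc p -> zfun p m (fun=> c).
Proof.
move=> cZ; apply: (eq_zfun (f := fun j => (c%:P).[j%:R])) => [j _|].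
  by rewrite hornerC.
by apply: zfun_poly; rewrite polyOverC.
Qed.

Lemma zfunX f k : zfun p m f -> zfun p m (fun j => f j ^+ k).
Proof.
move=> fZ; elim: k => [|k IH]; first by apply: zfun_cst; rewrite rpred1.
by apply: (eq_zfun _ (zfunM fZ IH)) => j _; rewrite exprS.
Qed.

Lemma zfun_sum (F : nat -> nat -> rat) k : (forall i, zfun p m (F i)) ->
  zfun p m (fun j => \sum_(i < k) F i j).
Proof.
move=> FZ; elim: k => [|k IH].
  apply: (@eq_zfun (fun=> 0)) => [j _|]; first by rewrite big_ord0.
  by apply: zfun_cst; rewrite rpred0.
by apply: (eq_zfun _ (zfunD IH (FZ k))) => j _; rewrite big_ord_recr.
Qed.

Lemma zone_zfun f : zone p m f -> zfun p m f.
Proof.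
case=> g gZ fE.
apply: (@eq_zfun (fun j => 1 + p%:R * g j)) => [j jm|]; first by rewrite fE.
apply: zfunD; first by apply: zfun_cst; rewrite rpred1.
by apply: zfunM => //; apply: zfun_cst; rewrite rpred_nat.
Qed.

Lemma zone_poly (P : {poly rat}) f : P \is a polyOver (Zloc p) ->
  (forall j, (j <= m)%N -> f j = 1 + p%:R * P.[j%:R]) -> zone p m f.
Proof. by move=> PZ fP; exists (fun j => P.[j%:R]) => //; apply: zfun_poly. Qed.

Lemma zone1 : zone p m (fun=> 1).
Proof.
by apply: (@zone_poly 0) => [|j _]; rewrite ?rpred0 // horner0 mulr0 addr0.
Qed.

Lemma zoneM f g : zone p m f -> zone p m g -> zone p m (fun j => f j * g j).
Proof.
move=> fZ [g' gZ gE]; have fZ' := zone_zfun fZ; case: fZ => f' fZ fE.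
exists (fun j => f' j + f j * g' j) => [|j jm].
  by apply: zfunD => //; apply: zfunM.
by rewrite gE // mulrDr mulr1 {1}fE //; ring.
Qed.

Lemma zone_prod (F : nat -> nat -> rat) k :
  (forall i, (i < k)%N -> zone p m (F i)) ->
  zone p m (fun j => \prod_(i < k) F i j).
Proof.
elim: k => [|k IH] FZ.
  by have [g gZ gE] := zone1; exists g => // j jm; rewrite big_ord0; apply: gE.
have [|g gZ gE] := zoneM (IH _) (FZ k (ltnSn k)).
  by move=> i ik; apply: FZ; apply: ltnW.
by exists g => // j jm; rewrite big_ord_recr -gE.
Qed.

(* With [x := - p * g], the last term of
   [1 / (1 - x) = 1 + x + ... + x ^ (m - 1) + x ^ m / (1 - x)]
   is an admissible error. *)
Lemma zoneV f : prime p -> zone p m f -> zone p m (fun j => (f j)^-1).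
Proof.
move=> p_pr [g gZ fE].
have f0 j : (j <= m)%N -> f j != 0.
  by move=> jm; rewrite fE // Zloc_1p_neq0 // (zfun_Zloc gZ).
have nZ : zfun p m (fun=> - p%:R) by apply: zfun_cst; rewrite rpredN rpred_nat.
have n1Z : zfun p m (fun=> -1) by apply: zfun_cst; rewrite rpredN rpred1.
have fVZ : zfun p m (fun j => (f j)^-1).
  pose F i j := (- p%:R * g j) ^+ i.
  apply: (@eq_zfun (fun j => \sum_(i < m) F i j +
                             p%:R ^+ m * ((- g j) ^+ m / f j))) => [j jm|].
    apply: (mulIf (f0 j jm)).
    rewrite mulVf ?f0 // mulrDl -!mulrA mulVf ?f0 // mulr1.
    rewrite -exprMn mulrN -mulNr.
    have := subrX1 (- p%:R * g j) m; rewrite -/(F m j) => E.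
    rewrite [X in _ * X]fE //; apply/eqP; rewrite -subr_eq0; apply/eqP.
    transitivity (F m j - 1 - (- p%:R * g j - 1) * \sum_(i < m) F i j).
      by rewrite /F; ring.
    by rewrite E subrr.
  apply: zfunD; first by apply: zfun_sum => i; apply: zfunX; apply: zfunM.
  apply: zfun_err => j jm; rewrite rpredM ?rpredX ?rpredN ?(zfun_Zloc gZ) //.
  by rewrite fE // Zloc_1pV // (zfun_Zloc gZ).
exists (fun j => -1 * g j * (f j)^-1) => [|j jm].
  by do 2!apply: zfunM => //.
apply: (mulIf (f0 j jm)); rewrite mulVf ?f0 // mulrDl -!mulrA mulVf ?f0 //.
by rewrite {1}fE //; ring.
Qed.

Lemma altsum_zfun f : prime p -> zfun p m f -> altsum m f / m`!%:R \in Zloc p.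
Proof.
move=> p_pr [P PZ fP].
(* The errors exist only separately for each [j]; dividing the difference by [p ^ m] expresses them
   as one function. *)
rewrite (@eq_altsum m f (fun j =>
  P.[j%:R] + p%:R ^+ m * ((f j - P.[j%:R]) / p%:R ^+ m))).
  rewrite altsumD altsumZ mulrDl rpredD ?altsum_Zloc //.
  rewrite mulrAC rpredM ?Zloc_exp_fact // rpred_sum // => j _.
  have [|e eZ ->] := fP j; first by rewrite -ltnS.
  rewrite addrAC subrr add0r [p%:R ^+ m * e]mulrC mulfK; last first.
    by rewrite expf_neq0 // pnatr_eq0 -lt0n prime_gt0.
  by rewrite rpredM // rpredM ?rpred_nat // rpredX // rpredN rpred1.
move=> j _; rewrite [X in _ + X]mulrC divfK.
  by rewrite addrC subrK.
by rewrite expf_neq0 // pnatr_eq0 -lt0n prime_gt0.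
Qed.

End Zfun.

(** * Residue classes and coefficients of powers of [1 - X] *)

(** The substitution is [k = r + q j], with inverse [k %/ q]; the two bounds on [n] say that [j = m]
    gives the last term. *)
Lemma big_residue (R : Type) (idx : R) (op : Monoid.com_law idx)
    (q r m n : nat) (F : nat -> R) :
  (r < q)%N -> (r + q * m <= n)%N -> (n < r + q * m.+1)%N ->
  \big[op/idx]_(k < n.+1 | (k %% q == r)%N) F k =
  \big[op/idx]_(j < m.+1) F (r + q * j)%N.
Proof.
move=> rq mn nm; have q0 : (0 < q)%N by apply: leq_ltn_trans rq.
rewrite (reindex_onto (fun j : 'I_m.+1 => inord (r + q * j) : 'I_n.+1)
                      (fun k => inord (k %/ q) : 'I_m.+1)) /=; last first.
  move=> k /eqP kr; apply: val_inj; rewrite /= inordK; last first.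
    rewrite ltnS inordK; first by have := divn_eq k q; have := ltn_ord k; nia.
    by have := divn_eq k q; have := ltn_ord k; rewrite !ltnS; nia.
  rewrite inordK; first by rewrite [RHS](divn_eq k q) kr addnC mulnC.
  by have := divn_eq k q; have := ltn_ord k; rewrite !ltnS; nia.
have E (j : 'I_m.+1) : (inord (r + q * j) : 'I_n.+1) = (r + q * j)%N :> nat.
  rewrite inordK // ltnS; apply: leq_trans mn.
  by rewrite leq_add2l leq_mul2l -ltnS ltn_ord orbT.
apply: eq_big => [j|j _]; last by rewrite E.
rewrite E mulnC addnC modnMDl modn_small // eqxx /=.
rewrite divnMDl // divn_small // addn0.
by apply/eqP/val_inj; rewrite /= inordK.
Qed.

Lemma intpoly_eq0_Fp (p : nat) (P : {poly int}) : prime p ->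
  map_poly (intr : int -> 'F_p) P = 0 -> exists R : {poly int}, P = p%:Z *: R.
Proof.
move=> p_pr P0; exists (map_poly (fun c => (c %/ p%:Z)%Z) P).
apply/polyP=> i; rewrite coefZ coef_map_id0 ?div0z // mulrC divzK //.
have := congr1 (fun Q : {poly 'F_p} => Q`_i) P0.
rewrite coef_map_id0 // coef0 => /eqP.
by rewrite -(dvdz_pcharf (pchar_Fp p_pr)).
Qed.

Lemma coef_1subX n k :
  ((1 - 'X) ^+ n : {poly int})`_k = (-1) ^+ k * 'C(n, k)%:R.
Proof.
rewrite exprDn coef_sum.
rewrite (eq_bigr (fun i : 'I_n.+1 => (-1) ^+ i * 'C(n, i)%:R * (k == i)%:R)).
  have [kn|nk] := ltnP k n.+1.
    rewrite (bigD1 (Ordinal kn)) //= eqxx mulr1 big1 ?addr0 // => i ik.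
    rewrite [_ == _](_ : _ = false) ?mulr0 //.
    by apply: contraNF ik => /eqP E; apply/eqP/val_inj.
  rewrite bin_small // mulr0 big1 // => i _.
  by rewrite (gtn_eqF (leq_trans (ltn_ord i) nk)) mulr0.
move=> i _; rewrite expr1n mul1r (exprNn 'X) coefMn.
have -> : (-1) ^+ i = ((-1) ^+ i)%:P :> {poly int} by rewrite rmorphXn rmorphN1.
by rewrite coefCM coefXn -[LHS]mulr_natr mulrAC.
Qed.

Lemma coef_1subX_rat n k :
  (((1 - 'X) ^+ n : {poly int})`_k)%:~R = (-1) ^+ k * 'C(n, k)%:R :> rat.
Proof. by rewrite coef_1subX rmorphM rmorphXn rmorphN1 /= rmorph_nat. Qed.

(** Over F_p the two powers agree by Frobenius, so the integral difference is divisible by [p]. The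
    size bound later discards the high coefficients of powers of [h]. *)
Lemma Frobenius_1subX p : prime p -> exists2 h : {poly int},
  (1 - 'X) ^+ p = (1 - 'X) \Po 'X^p + p%:Z *: h & (size h <= p.+1)%N.
Proof.
move=> p_pr.
have [|h hE] := @intpoly_eq0_Fp p ((1 - 'X) ^+ p - (1 - 'X^p)) p_pr.
  rewrite !rmorphB rmorphXn rmorphB !rmorph1 /= map_polyXn map_polyX.
  have ch : p \in [pchar {poly 'F_p}] by rewrite pchar_poly; apply: pchar_Fp.
  rewrite -(pFrobenius_autE ch) pFrobenius_autB_comm; last exact: mulrC.
  by rewrite pFrobenius_aut1 pFrobenius_autE subrr.
exists h.
  by rewrite -hE rmorphB rmorph1 /= comp_polyX [RHS]addrC subrK.
have p0 : p%:Z != 0 by rewrite eqz_nat -lt0n prime_gt0.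
rewrite -(size_scale h p0) -hE; apply: leq_trans (size_polyD _ _) _.
have s2 : size (1 - 'X : {poly int}) = 2.
  by rewrite -opprB size_polyN size_XsubC.
rewrite size_polyN geq_max; apply/andP; split.
  by apply: leq_trans (size_poly_exp_leq _ _) _; rewrite s2 mul1n.
by rewrite -opprB size_polyN -polyC1 size_XnsubC ?prime_gt0.
Qed.

(** The first factor has only exponents divisible by [p]. The range of the sum is stretched to [m],
    independent of [j], so that it can later become a polynomial in [j]. *)
Lemma coef_comp_XnM (p m j : nat) (Q H : {poly int}) :
  (0 < p)%N -> (j <= m)%N ->
  ((Q \Po 'X^p) * H)`_(p * j) =
  \sum_(i < m.+1) (if (i <= j)%N then Q`_(j - i) else 0) * H`_(p * i).
Proof.
move=> p0 jm; rewrite coefMr.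
pose F i := (if (p %| i)%N then Q`_(j - i %/ p) * H`_i else 0).
rewrite (eq_bigr (fun i : 'I_(p * j).+1 => F i)).
  rewrite -big_mkcond.
  rewrite (eq_bigl (fun i : 'I_(p * j).+1 => (i %% p == 0)%N)) //.
  rewrite (@big_residue _ _ _ p 0 j _ (fun i => Q`_(j - i %/ p) * H`_i)) //;
    last first.
    by rewrite !add0n ltn_pmul2l.
  rewrite (big_ord_widen m.+1
    (fun i => Q`_(j - (0 + p * i) %/ p) * H`_(0 + p * i))) //.
  rewrite big_mkcond; apply: eq_bigr => i _.
  by rewrite add0n mulKn // ltnS; case: ifP => // _; rewrite mul0r.
move=> [i /= ij] _; rewrite coef_comp_poly_Xn // /F.
have [/dvdnP[i' E]|pi] := boolP (p %| i)%N.
  by rewrite E [(i' * p)%N]mulnC -mulnBr dvdn_mulr // !mulKn.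
rewrite ifN ?mul0r //; apply: contra pi => pji.
by rewrite -[i](subKn (n := p * j)) // dvdn_sub // dvdn_mulr.
Qed.

(** * Binomial coefficients at multiples of [p ^ alpha] *)

Definition ffact_poly (x : {poly rat}) (k : nat) : {poly rat} :=
  \prod_(t < k) (x - t%:R%:P).

Lemma ffact_polyE (x : {poly rat}) (a : rat) (n k : nat) :
  x.[a] = n%:R -> (ffact_poly x k).[a] = (n ^_ k)%:R.
Proof.
move=> xa; elim: k => [|k IH]; first by rewrite /ffact_poly big_ord0 hornerC.
rewrite /ffact_poly big_ord_recr /= hornerM IH ffactnSr natrM.
rewrite hornerD hornerN hornerC xa.
have [kn|nk] := leqP k n; first by rewrite natrB.
by rewrite ffact_small // !mul0r.
Qed.

Lemma polyOver_ffact_poly p (x : {poly rat}) k :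
  x \is a polyOver (Zloc p) -> ffact_poly x k \is a polyOver (Zloc p).
Proof.
move=> xZ; apply: rpred_prod => t _.
by rewrite rpredB // polyOverC rpred_nat.
Qed.

(** Multiplied by the factorials of [j - i] and [m - k - (j - i)], both sides become [m] factorial;
    out of range both vanish. It shows that, relative to ['C(m, j)], the left side is polynomial in
    [j]. *)
Lemma bin_ffact_shift (m k i j : nat) : (i <= k <= m)%N -> (j <= m)%N ->
  ('C(m, k) * (if i <= j then 'C(m - k, j - i) else 0) * k`! =
   'C(m, j) * (j ^_ i * (m - j) ^_ (k - i)))%N.
Proof.
move=> /andP[ik km] jm; case: leqP => [ij|ji]; last first.
  by rewrite (ffact_small ji) mul0n !muln0.
have [kij|kij] := leqP (k - i) (m - j); last first.
  have mkji : (m - k < j - i)%N by lia.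
  by rewrite (ffact_small kij) (bin_small mkji) !muln0.
have jimk : (j - i <= m - k)%N by lia.
have E : (m - j - (k - i) = m - k - (j - i))%N by lia.
have F0 : (0 < (j - i)`! * (m - k - (j - i))`!)%N by rewrite muln_gt0 !fact_gt0.
apply/eqP; rewrite -(eqn_pmul2r F0); apply/eqP.
transitivity (m`!).
  rewrite -(bin_fact km) -(bin_fact jimk); ring.
rewrite -(bin_fact jm) -(ffact_fact ij) -(ffact_fact kij) E; ring.
Qed.

Lemma signed_bin_mulp (p m : nat) : prime p ->
  exists2 P : {poly rat}, P \is a polyOver (Zloc p) &
  forall j, (j <= m)%N ->
    (-1) ^+ (p * j) * 'C(p * m, p * j)%:R =
    (-1) ^+ j * 'C(m, j)%:R * (1 + p%:R * P.[j%:R]) :> rat.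
Proof.
move=> p_pr; have [h hE sh] := Frobenius_1subX p_pr.
have p0 := prime_gt0 p_pr.
(* The sign [(-1) ^ i] in [c] is what remains of [(-1) ^ (j - i)] once [(-1) ^ j] is factored
   out. *)
pose c k i : rat := (-1) ^+ i * ((h ^+ k)`_(p * i))%:~R.
pose G k i := ffact_poly 'X i * ffact_poly (m%:R%:P - 'X) (k - i).
exists (\sum_(k < m) (p%:R ^+ k / (k.+1)`!%:R) *:
          \sum_(i < m.+1) c k.+1 i *: G k.+1 i).
  apply: rpred_sum => k _; apply: polyOverZ; first exact: Zloc_exp_factS.
  apply: rpred_sum => i _; apply: polyOverZ.
    by rewrite rpredM ?rpredX ?rpredN ?rpred1 // rpred_int.
  rewrite rpredM // polyOver_ffact_poly //.
    exact: polyOverX.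
  by rewrite rpredB ?polyOverX ?polyOverC ?rpred_nat.
move=> j jm.
rewrite -coef_1subX_rat exprM hE exprDn coef_sum rmorph_sum.
rewrite big_ord_recl /= subn0 expr0 mulr1 bin0 mulr1n.
rewrite -rmorphXn /= coef_comp_poly_Xn // dvdn_mulr // mulKn // coef_1subX_rat.
rewrite mulrDr mulr1; congr (_ + _).
rewrite horner_sum !mulr_sumr; apply: eq_bigr => k _.
rewrite /bump leq0n add1n coefMn exprZn -scalerAr coefZ.
rewrite -(rmorphXn (comp_poly 'X^p)) /=.
rewrite (@coef_comp_XnM p m) // hornerZ horner_sum.
rewrite rmorphMn rmorphM rmorph_sum /=.
rewrite -mulr_natr !mulr_sumr mulr_suml; apply: eq_bigr => i _.
rewrite hornerZ hornerM (@ffact_polyE _ _ j) ?hornerX //.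
rewrite (@ffact_polyE _ _ (m - j)); last first.
  by rewrite hornerD hornerN hornerC hornerX natrB.
rewrite rmorphM /=.
(* For [i > k.+1] the exponent [p * i] exceeds the degree of [h ^+ k.+1]. *)
have [ik|ki] := leqP i k.+1; last first.
  suff H0 : (h ^+ k.+1)`_(p * i) = 0 by rewrite /c H0 !(mulr0z, mulr0, mul0r).
  apply: nth_default; apply: leq_trans (size_poly_exp_leq _ _) _.
  have : ((size h).-1 <= p)%N by rewrite -subn1 leq_subLR add1n.
  by move=> sh'; nia.
have km : (k < m)%N := ltn_ord k.
have E : 'C(m, k.+1)%:R * (if (i <= j)%N then 'C(m - k.+1, j - i) else 0)%:R
         * (k.+1)`!%:R =
         'C(m, j)%:R * ((j ^_ i)%:R * ((m - j) ^_ (k.+1 - i))%:R) :> rat.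
  by rewrite -!natrM bin_ffact_shift // ik km.
have f0 : (k.+1)`!%:R != 0 :> rat by rewrite pnatr_eq0 -lt0n fact_gt0.
apply: (mulIf f0).
transitivity ((p%:R ^+ k.+1 * (-1) ^+ j * c k.+1 i) *
  ('C(m, k.+1)%:R * (if (i <= j)%N then 'C(m - k.+1, j - i) else 0)%:R
   * (k.+1)`!%:R)).
  rewrite /c; case: leqP => ij; last by rewrite !(mul0r, mulr0).
  rewrite coef_1subX_rat rmorphXn /= -pmulrn.
  have -> : (-1) ^+ j = (-1) ^+ (j - i) * (-1) ^+ i :> rat.
    by rewrite -exprD subnK.
  have := sqrr_sign rat i.
  rewrite -[(-1) ^+ i ^+ 2]/((-1) ^+ i * (-1) ^+ i) => S.
  rewrite -[LHS]mulr1 -[X in _ * X = _]S; ring.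
rewrite E exprS; field.
by [].
Qed.

(** Induction on [alpha]: one more factor [p] is handled by [signed_bin_mulp] at [p ^ alpha * m],
    with [p ^ alpha X] substituted into its polynomial, and the two corrections are multiplied. *)
Lemma signed_bin_mulpX (p alpha m : nat) : prime p ->
  exists2 P : {poly rat}, P \is a polyOver (Zloc p) &
  forall j, (j <= m)%N ->
    (-1) ^+ (p ^ alpha * j) * 'C(p ^ alpha * m, p ^ alpha * j)%:R =
    (-1) ^+ j * 'C(m, j)%:R * (1 + p%:R * P.[j%:R]) :> rat.
Proof.
move=> p_pr; elim: alpha => [|alpha [P PZ PE]].
  exists 0 => [|j _]; first exact: rpred0.
  by rewrite expn0 !mul1n horner0 mulr0 addr0 mulr1.
have [Q QZ QE] := signed_bin_mulp (p ^ alpha * m) p_pr.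
set Q' := Q \Po ((p ^ alpha)%:R *: 'X).
have QZ' : Q' \is a polyOver (Zloc p).
  by apply: polyOver_comp => //; rewrite polyOverZ ?polyOverX ?rpred_nat.
exists (P + Q' + p%:R *: (P * Q')) => [|j jm].
  by rewrite !rpredD ?polyOverZ ?rpredM ?rpred_nat.
rewrite expnS -!mulnA QE ?leq_mul2l ?jm ?orbT // PE //.
rewrite !(hornerD, hornerZ, hornerM) horner_comp hornerZ hornerX natrM; ring.
Qed.

(** * Removing the residues from the binomial coefficients *)

(** In this form, when [p ^ alpha] divides [x], each factor whose denominator is not a multiple of
    [p ^ alpha] is 1 modulo [p]. *)
Lemma prod_1add_bin (x r : nat) :
  \prod_(t < r) (1 + x%:R / t.+1%:R) = 'C(x + r, r)%:R :> rat.
Proof.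
elim: r => [|r IH]; first by rewrite big_ord0 bin0.
rewrite big_ord_recr /= IH.
have r0 : r.+1%:R != 0 :> rat by rewrite pnatr_eq0.
apply: (mulIf r0); rewrite -mulrA mulrDl mul1r divfK // -natrD -!natrM.
congr (_%:R); rewrite [RHS]mulnC addnS -mul_bin_diag /= mulnC.
by congr muln; lia.
Qed.

(** Multiplied by the factorials of [a], [b], [r], [s], both sides become the factorial of the
    total. *)
Lemma bin_split (a b r s : nat) :
  ('C(a + b + (r + s), r + a) * ('C(a + r, r) * 'C(b + s, s)) =
   'C(a + b, a) * 'C(r + s, r) * 'C(a + b + (r + s), r + s))%N.
Proof.
have F0 : (0 < r`! * s`! * (a`! * b`!))%N by rewrite !muln_gt0 !fact_gt0.
apply/eqP; rewrite -(eqn_pmul2r F0); apply/eqP.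
have E1 : (a + b + (r + s) - (r + a) = b + s)%N by lia.
have e1 := @bin_fact (a + b + (r + s)) (r + a); rewrite E1 in e1.
have e2 := @bin_fact (a + r) r; rewrite addnK in e2.
have e3 := @bin_fact (b + s) s; rewrite addnK in e3.
have e4 := @bin_fact (a + b) a; rewrite addKn in e4.
have e5 := @bin_fact (r + s) r; rewrite addKn in e5.
have e6 := @bin_fact (a + b + (r + s)) (r + s); rewrite addnK in e6.
transitivity ((a + b + (r + s))`!).
  rewrite -e1 ?[(r + a)%N]addnC -?e2 -?e3; [ring|lia..].
rewrite -e6 -?e4 -?e5; [ring|lia..].
Qed.

Section UnitCongruence.
Variable p : nat.

Definition one_modp (x : rat) : Prop :=
  exists2 z, z \in Zloc p & x = 1 + p%:R * z.

Lemma one_modp1 : one_modp 1.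
Proof. by exists 0; rewrite ?rpred0 // mulr0 addr0. Qed.

Lemma one_modpM x y : one_modp x -> one_modp y -> one_modp (x * y).
Proof.
move=> [z zZ ->] [t tZ ->]; exists (z + t + p%:R * (z * t)); last by ring.
by rewrite !rpredD ?rpredM ?rpred_nat.
Qed.

Hypothesis p_pr : prime p.

(** In the product of [prod_1add_bin] the only denominator divisible by [q] can be [q] itself, as
    [n < 2 q - 1]. It occurs when [q <= n], and its factor [m.+1] is the quotient of the two
    factorials. *)
Lemma bin_one_modp (alpha m n : nat) (q := (p ^ alpha)%N) : (n.+1 < q + q)%N ->
  one_modp ('C(q * m + n, n)%:R * m`!%:R / ((q * m + n) %/ q)`!%:R).
Proof.
move=> n2q; have q0 : (0 < q)%N by rewrite expn_gt0 prime_gt0.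
have H t : (t.+1 < q + q)%N -> t != q.-1 -> one_modp (1 + (q * m)%:R / t.+1%:R).
  move=> tq tq1; have [|z zZ zE] := @Zloc_ratio p alpha t.+1 p_pr.
    rewrite -/q; apply/negP => /dvdnP[c cE].
    have : (0 < c < 2)%N by nia.
    move=> c1; have c1' : c = 1%N by lia.
    move/eqP: tq1; move: cE; by rewrite c1' mul1n; lia.
  exists (m%:R * z); first by rewrite rpredM ?rpred_nat.
  by rewrite natrM mulrAC zE; ring.
have m0 : m`!%:R != 0 :> rat by rewrite pnatr_eq0 -lt0n fact_gt0.
rewrite mulnC divnMDl // -prod_1add_bin.
have [nq|qn] := ltnP n q.
  rewrite divn_small // addn0 mulfK //.
  apply: (big_ind one_modp one_modp1 one_modpM) => t _.
  have := ltn_ord t; rewrite [(m * q)%N]mulnC => tn; apply: H; first by lia.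
  by apply/eqP => tE; lia.
have -> : (n %/ q = 1)%N.
  by rewrite -(subnK qn) addnC divnDl ?divnn ?q0 // divn_small //; lia.
have q1n : (q.-1 < n)%N by rewrite prednK.
rewrite (bigD1 (Ordinal q1n)) //= addn1 factS (natrM _ m.+1) prednK //.
have -> : 1 + (m * q)%:R / q%:R = m.+1%:R :> rat.
  by rewrite natrM mulfK ?pnatr_eq0 -?lt0n // -natr1 addrC.
have m1 : m.+1%:R != 0 :> rat by rewrite pnatr_eq0.
rewrite [m.+1%:R * \prod_(_ < _ | _) _]mulrC -(mulrA (bigop _ _ _)).
rewrite mulfK ?mulf_neq0 //.
apply: (big_ind one_modp one_modp1 one_modpM) => t tq.
have := ltn_ord t; rewrite [(m * q)%N]mulnC => tn; apply: H; first by lia.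
by apply: contra tq => /eqP tE; apply/eqP/val_inj.
Qed.

(** All denominators in [prod_1add_bin] are at most [r], hence below [p ^ alpha], so every factor is
    1 modulo [p] and linear in [j]. *)
Lemma zone_bin (alpha m r : nat) : (r < p ^ alpha)%N ->
  zone p m (fun j => 'C(p ^ alpha * j + r, r)%:R).
Proof.
move=> rq.
have [|g gZ gE] :=
  @zone_prod p m (fun t j => 1 + (p ^ alpha * j)%:R / t.+1%:R) r.
  move=> t tr; have [|z zZ zE] := @Zloc_ratio p alpha t.+1 p_pr.
    by rewrite gtnNdvd // (leq_ltn_trans tr).
  apply: (@zone_poly _ _ (z *: 'X)) => [|j _].
    by rewrite polyOverZ ?polyOverX.
  by rewrite natrM mulrAC zE hornerZ hornerX; ring.
by exists g => // j jm; rewrite -prod_1add_bin gE.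
Qed.

Lemma zone_rev m (f : nat -> rat) :
  zone p m f -> zone p m (fun j => f (m - j)%N).
Proof.
case=> g [P PZ gE] fE; exists (fun j => g (m - j)%N) => [|j jm].
  exists (P \Po (m%:R%:P - 'X)) => [|j jm].
    by rewrite polyOver_comp // rpredB ?polyOverX ?polyOverC ?rpred_nat.
  have [|e eZ ->] := gE (m - j)%N; first exact: leq_subr.
  by exists e => //; rewrite horner_comp hornerD hornerN hornerC hornerX natrB.
by rewrite fE // leq_subr.
Qed.

End UnitCongruence.

(** * Divisibility of polynomials over F_p *)

Section PrimeField.
Variables (p : nat) (p_pr : prime p).

Let X_Fp : {poly 'F_p} := 'X.

Lemma prod_XsubC_Fp : \prod_(i < p) (X_Fp - (i%:R)%:P) = X_Fp ^+ p - X_Fp.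
Proof.
have := finField_genPoly 'F_p; rewrite card_Fp // => ->.
(* The elements of ['F_p] form an ordinal type whose bound equals [p] only propositionally, so the
   range is changed by an equation. *)
have castE n : n = p -> \prod_(i < p) (X_Fp - (i%:R)%:P) =
                        \prod_(i < n) (X_Fp - (i%:R)%:P) by move->.
rewrite (castE _ (Fp_cast p_pr)).
by apply: eq_bigr => x _; rewrite natr_Zp.
Qed.

(** Each block of [p] consecutive integers runs once through F_p. *)
Lemma prod_XsubC_FpM u :
  \prod_(i < u * p) (X_Fp - (i%:R)%:P) = (X_Fp ^+ p - X_Fp) ^+ u.
Proof.
elim: u => [|u IH]; first by rewrite big_ord0.
rewrite -(big_mkord xpredT (fun i => X_Fp - (i%:R)%:P)) mulSn addnC.
rewrite (big_cat_nat (n := (u * p)%N)) ?leq_addr //= big_mkord IH exprSr.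
congr (_ * _).
rewrite -{1}[(u * p)%N]add0n big_addn addKn big_mkord -prod_XsubC_Fp.
by apply: eq_bigr => i _; rewrite natrD natrM pchar_Fp_0 // mulr0 addr0.
Qed.

Lemma exprB_pcharX (x y : {poly 'F_p}) e :
  (x - y) ^+ (p ^ e) = x ^+ (p ^ e) - y ^+ (p ^ e).
Proof.
have ch : p \in [pchar {poly 'F_p}] by rewrite pchar_poly; apply: pchar_Fp.
elim: e => [|e IH]; first by rewrite expn0 !expr1.
rewrite expnSr !exprM IH -!(pFrobenius_autE ch) pFrobenius_autB_comm //.
exact: mulrC.
Qed.

Lemma genPoly_translate (a : 'F_p) (Y := X_Fp - a%:P) :
  X_Fp ^+ p - X_Fp = Y ^+ p - Y.
Proof.
have := exprB_pcharX X_Fp a%:P 1; rewrite expn1 /Y => ->.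
have ap : a ^+ p = a by rewrite -{2}(expf_card a) card_Fp.
by rewrite -polyC_exp ap; ring.
Qed.

(** [X ^ p - X] is invariant under translation by F_p, and its [p ^ e]-th power is computed
    termwise. The modulus [(p - 1) * p ^ e] of the congruence on [l] arises here. *)
Lemma genPolyX_translate (a : 'F_p) e (Y := X_Fp - a%:P) :
  (X_Fp ^+ p - X_Fp) ^+ (p ^ e) = Y ^+ (p ^ e) * (Y ^+ ((p - 1) * p ^ e) - 1).
Proof.
rewrite (genPoly_translate a) -/Y exprB_pcharX -exprM mulrBr mulr1 -exprD.
congr (_ ^+ _ - _).
by have := prime_gt0 p_pr; case: (p) => // k _; rewrite subn1 /= mulSn.
Qed.

Lemma dvdp_expB (Y : {poly 'F_p}) b A l m : (b <= m <= l)%N -> (A %| l - m)%N ->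
  Y ^+ b * (Y ^+ A - 1) %| Y ^+ l - Y ^+ m.
Proof.
move=> /andP[bm ml] /dvdnP[t tE].
have -> : Y ^+ l - Y ^+ m = Y ^+ m * (Y ^+ (A * t) - 1).
  by rewrite mulrBr mulr1 -exprD mulnC -tE subnKC.
by apply: dvdp_mul; rewrite ?dvdp_exp2l // exprM [X in _ %| X]subrX1 dvdp_mulr.
Qed.

(** In general, with [e] the logarithm of [m], the nodes lie below [p ^ e.+1], so their product
    divides [(X ^ p - X) ^ (p ^ e) = Y ^ (p ^ e) (Y ^ A - 1)] for [A = (p - 1) p ^ e], and
    [p ^ e <= m]. The flag [b] marks the case where the exponent in [A] may be one smaller. *)
Lemma node_poly_dvd (a : 'F_p) (l m : nat) (b : bool) (Y := X_Fp - a%:P) :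
  (0 < m <= l)%N ->
  (b -> a = 0 /\ exists2 e, (0 < e)%N & m = (p ^ e)%N) ->
  ((p - 1) * p ^ (trunc_log p m - b) %| l - m)%N ->
  \prod_(i < m.+1) (X_Fp - (i%:R)%:P) %| Y ^+ l - Y ^+ m.
Proof.
move=> /andP[m0 ml] bP; have p1 := prime_gt1 p_pr.
case: b bP => [/(_ isT)[a0 [[|e] // _ mE]]|_] lm.
  subst m; have {}lm : ((p - 1) * p ^ e %| l - p ^ e.+1)%N.
    by move: lm; rewrite trunc_expnK //= subSS subn0.
  have pe0 : (p ^ e.+1)%:R = 0 :> 'F_p by rewrite natrX pchar_Fp_0 // expr0n.
  (* The last node [p ^ e.+1] is 0 in F_p, as is [a], and contributes one more factor [Y]; the
     exponent [(p ^ e).+1] is still at most [m]. *)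
  apply: dvdp_trans (dvdp_expB (b := (p ^ e).+1) Y _ lm); last first.
    by rewrite ltn_exp2l // ml ltnSn.
  rewrite big_ord_recr /= pe0 subr0 expnSr prod_XsubC_FpM.
  by rewrite (genPolyX_translate a) -/Y exprSr /Y a0 subr0 mulrAC.
rewrite subn0 in lm; set e := trunc_log p m in lm.
have pm : (p ^ e <= m)%N by apply: trunc_logP.
apply: dvdp_trans (dvdp_expB (b := p ^ e) Y _ lm); last by rewrite pm.
rewrite -(genPolyX_translate a) -prod_XsubC_FpM -expnSr.
have mp : (m.+1 <= p ^ e.+1)%N by apply: trunc_log_ltn.
rewrite -!(big_mkord xpredT (fun i => X_Fp - (i%:R)%:P)).
by rewrite [X in _ %| X](big_cat_nat (n := m.+1)) //= dvdp_mulr.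
Qed.

Lemma lift_Fp_poly (Q : {poly 'F_p}) :
  exists Q' : {poly int}, map_poly (intr : int -> 'F_p) Q' = Q.
Proof.
exists (map_poly (fun x : 'F_p => (x : nat)%:Z) Q).
by apply/polyP=> i; rewrite !coef_map_id0 //= -pmulrn natr_Zp.
Qed.

(** The divisibility lifts to [Y ^ l = Y ^ m + Q W + p R] over the integers. [W] vanishes at the
    nodes, [R] contributes [p] times a [p]-integral number, and [Y ^ m] is monic of degree [m]. *)
Lemma altsum_exp (a : int) (l m : nat) (b : bool) :
  (0 < m <= l)%N ->
  (b -> (p%:Z %| a)%Z /\ exists2 e, (0 < e)%N & m = (p ^ e)%N) ->
  ((p - 1) * p ^ (trunc_log p m - b) %| l - m)%N ->
  exists2 z, z \in Zloc p &
    altsum m (fun j => (j%:R - a%:~R) ^+ l) / m`!%:R = (-1) ^+ m + p%:R * z.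
Proof.
move=> ml bP lm; pose Y : {poly int} := 'X - a%:P.
pose W : {poly int} := \prod_(i < m.+1) ('X - (i%:Z)%:P).
have [|Qp QpE] := dvdpP _ _ (@node_poly_dvd a%:~R l m b ml _ lm).
  move=> /bP[pa mE]; split=> //; apply/eqP.
  by rewrite -(dvdz_pcharf (pchar_Fp p_pr)).
have [Q QE] := lift_Fp_poly Qp.
have YE : map_poly (intr : int -> 'F_p) Y = X_Fp - (a%:~R)%:P.
  by rewrite rmorphB /= map_polyX map_polyC.
have WE : map_poly (intr : int -> 'F_p) W = \prod_(i < m.+1) (X_Fp - (i%:R)%:P).
  rewrite rmorph_prod; apply: eq_bigr => i _.
  by rewrite rmorphB /= map_polyX map_polyC.
have [|R RE] := @intpoly_eq0_Fp p (Y ^+ l - Y ^+ m - Q * W) p_pr.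
  by rewrite !rmorphB !rmorphXn rmorphM /= YE WE QE QpE subrr.
pose toQ := map_poly (intr : int -> rat).
have evY k (j : nat) : (toQ (Y ^+ k)).[j%:R] = (j%:R - a%:~R) ^+ k.
  rewrite /toQ rmorphXn rmorphB /= map_polyX map_polyC.
  by rewrite horner_exp hornerXsubC.
have evW (j : nat) : (j <= m)%N -> (toQ (Q * W)).[j%:R] = 0.
  move=> jm; rewrite /toQ rmorphM rmorph_prod hornerM horner_prod.
  rewrite (bigD1 (Ordinal (jm : (j < m.+1)%N))) //=.
  rewrite rmorphB /= map_polyX map_polyC hornerXsubC.
  by rewrite subrr mul0r mulr0.
exists (altsum m (fun j => (toQ R).[j%:R]) / m`!%:R).
  by apply: altsum_Zloc; apply/polyOverP => i; rewrite coef_map rpred_int.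
have m0 : m`!%:R != 0 :> rat by rewrite pnatr_eq0 -lt0n fact_gt0.
rewrite (eq_altsum (g := fun j =>
  (toQ (Y ^+ m)).[j%:R] + p%:R * (toQ R).[j%:R])).
  have sY : size (toQ (Y ^+ m)) = m.+1.
    by rewrite /toQ rmorphXn rmorphB /= map_polyX map_polyC size_exp_XsubC.
  rewrite altsumD altsumZ mulrDl mulrA; congr (_ + _).
  rewrite altsum_lead ?sY // mulrAC mulfK // .
  have : toQ (Y ^+ m) \is monic.
    rewrite /toQ rmorphXn rmorphB /= map_polyX map_polyC.
    by rewrite monic_exp // monicXsubC.
  by rewrite monicE lead_coefE sY /= => /eqP ->; rewrite mulr1.
move=> j jm; rewrite -evY.
have -> : Y ^+ l = Y ^+ m + Q * W + p%:Z *: R by rewrite -RE; ring.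
rewrite /toQ !rmorphD /= !hornerD evW // addr0; congr (_ + _).
by rewrite map_polyZ hornerZ.
Qed.

End PrimeField.

(** * Assembling the congruence *)

(** [bin_split] with [a = q j] and [b = q (m - j)] reduces to [signed_bin_mulpX]; the two extra
    binomials [u] and [v] are 1 modulo [p] and are inverted by [zoneV]. *)
Lemma signed_bin_residue (p alpha m r s : nat) (q := (p ^ alpha)%N) :
  prime p -> (r < q)%N -> (s < q)%N ->
  exists2 g, zone p m g & forall j, (j <= m)%N ->
    (-1) ^+ (r + q * j) * 'C(q * m + (r + s), r + q * j)%:R =
    (-1) ^+ r * 'C(r + s, r)%:R * 'C(q * m + (r + s), r + s)%:R *
    ((-1) ^+ j * 'C(m, j)%:R * g j) :> rat.
Proof.
move=> p_pr rq sq; have [P PZ PE] := signed_bin_mulpX alpha m p_pr.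
pose u j : rat := 'C(q * j + r, r)%:R.
pose v j : rat := 'C(q * (m - j) + s, s)%:R.
exists (fun j => (1 + p%:R * P.[j%:R]) * ((u j)^-1 * (v j)^-1)) => [|j jm].
  apply: zoneM; first exact: (zone_poly PZ).
  apply: zoneM; apply: (zoneV p_pr); first exact: zone_bin.
  exact: (zone_rev (zone_bin p_pr _ sq)).
have u0 : u j != 0 by rewrite pnatr_eq0 -lt0n bin_gt0 leq_addl.
have v0 : v j != 0 by rewrite pnatr_eq0 -lt0n bin_gt0 leq_addl.
have E : 'C(q * m + (r + s), r + q * j)%:R * (u j * v j) =
    'C(q * m, q * j)%:R * 'C(r + s, r)%:R * 'C(q * m + (r + s), r + s)%:R
    :> rat.
  have := bin_split (q * j) (q * (m - j)) r s.
  rewrite -mulnDr subnKC // => Enat.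
  by rewrite -!natrM Enat.
apply: (mulIf (mulf_neq0 u0 v0)).
rewrite -[LHS]mulrA E exprD.
transitivity ((-1) ^+ r * 'C(r + s, r)%:R * 'C(q * m + (r + s), r + s)%:R *
              ((-1) ^+ (q * j) * 'C(q * m, q * j)%:R) : rat); first by ring.
rewrite PE //; field.
by rewrite u0 v0.
Qed.

(** For odd [p] the signs agree since [p - 1] is even; for [p = 2] any two signs differ by an even
    number. This turns the [(-1) ^ m] of [altsum_exp] into [(-1) ^ l]. *)
Lemma sign_congr (p l m : nat) : prime p -> (m <= l)%N -> (p - 1 %| l - m)%N ->
  exists2 z, z \in Zloc p & (-1) ^+ m = (-1) ^+ l + p%:R * z.
Proof.
move=> p_pr ml plm; case: (even_prime p_pr) => [->|odd_p].
  exists (((-1) ^+ m - (-1) ^+ l) / 2%:R); last by field.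
  rewrite -(signr_odd _ m) -(signr_odd _ l).
  by case: (odd m); case: (odd l).
exists 0; first exact: rpred0.
rewrite mulr0 addr0 -(subnK ml) exprD -(signr_odd _ (l - m)).
have -> : odd (l - m) = false; last by rewrite mul1r.
have : (2 %| p - 1)%N by rewrite dvdn2 oddB ?prime_gt0 // odd_p.
by move/dvdn_trans/(_ plm); rewrite dvdn2 => /negbTE.
Qed.

Theorem theorem1p2 (p alpha l n : nat) (r : int) :
  prime p ->
  let q := (p ^ alpha)%N in
  let r' := rstar p alpha r in
  let n' := nstar p alpha n r in
  let m := mquot p alpha n r in
  0 < m ->
  m <= l%:Z ->
  (l%:Z = m %[mod ((p - 1) *
     p ^ (trunc_log p `|m| - delta p (r %/ q%:Z)%Z `|m|))%N%:Z])%Z ->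
  congr_Zp p
    (((n %/ q)`! * 'C(n', r'))%N%:R^-1 *
     \sum_(k < n.+1 | (k%:Z == r %[mod q%:Z])%Z)
        (-1) ^+ k * 'C(n, k)%:R * ((k%:Z - r)%:~R / q%:R) ^+ l)
    ((-1) ^+ (l + r')%N).
Proof.
move=> p_pr q r' n' m m0 ml lm.
have q0 : (0 < q)%N by rewrite expn_gt0 prime_gt0.
have qz0 : q%:Z != 0 by rewrite eqz_nat -lt0n.
set a := (r %/ q%:Z)%Z in lm *.
set s := absz ((n%:Z - r) %% q%:Z)%Z.
have nE' : n' = (r' + s)%N by [].
have rE' : r'%:Z = (r %% q%:Z)%Z by rewrite /r' /rstar gez0_abs ?modz_ge0.
have sE : s%:Z = ((n%:Z - r) %% q%:Z)%Z by rewrite gez0_abs ?modz_ge0.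
have rq : (r' < q)%N by rewrite -ltz_nat rE' ltz_pmod // ltz_nat.
have sq : (s < q)%N by rewrite -ltz_nat sE ltz_pmod // ltz_nat.
have rE : r = a * q%:Z + r'%:Z by rewrite rE' -divz_eq.
have mE := @mquot_exact p alpha n r p_pr; rewrite -/m -/q -/n' in mE.
case: m m0 ml lm mE => // M m0 ml lm mE; rewrite /= in lm.
have nE : n = (q * M + (r' + s))%N.
  by apply/eqP; rewrite -nE' -eqz_nat PoszD PoszM mulrC mE subrK.
have {}ml : (M <= l)%N by [].
have {}lm : ((p - 1) * p ^ (trunc_log p M - delta p a M) %| l - M)%N.
  move/eqP: lm; rewrite eqz_mod_dvd subzn // dvdzE /=; exact.
pose b := (p%:Z %| a)%Z && log_pos_int p M.
have [|||z zZ zE] := @altsum_exp p p_pr a l M b.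
- by rewrite ml andbT.
- by move=> /andP[pa /(log_pos_intP _ p_pr)]; split.
- by move: lm; rewrite /delta -/b; case: (b).
have [g [g1 g1Z gE] binE] := @signed_bin_residue p alpha M r' s p_pr rq sq.
rewrite -/q in binE.
have [|w wZ wE] := @bin_one_modp p p_pr alpha M (r' + s).
  by have := leq_add rq sq; rewrite addSn addnS.
rewrite -/q -nE in wE.
have [|y yZ yE] := sign_congr p_pr ml.
  by apply: dvdn_trans lm; rewrite dvdn_mulr.
set f := fun j : nat => (j%:R - a%:~R) ^+ l : rat.
have fZ : zfun p M f.
  apply: zfunX; apply: (@eq_zfun p M (fun j => ('X - (a%:~R)%:P).[j%:R])).
    by move=> j _; rewrite hornerXsubC.
  by apply: zfun_poly; rewrite rpredB ?polyOverX ?polyOverC ?rpred_int.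
(* The deviation [p * g1] of [g] from 1 contributes [p] times this [p]-integral number. *)
have hZ := altsum_zfun p_pr (zfunM g1Z fZ).
have -> : \sum_(k < n.+1 | (k%:Z == r %[mod q%:Z])%Z)
    (-1) ^+ k * 'C(n, k)%:R * ((k%:Z - r)%:~R / q%:R) ^+ l =
  (-1) ^+ r' * 'C(n', r')%:R * 'C(n, n')%:R *
  (altsum M f + p%:R * altsum M (fun j => g1 j * f j)) :> rat.
  rewrite (eq_bigl (fun k : 'I_n.+1 => (k %% q == r')%N)); last first.
    by move=> k; rewrite modz_nat -rE'.
  rewrite (@big_residue _ _ _ q r' M n (fun k : nat => (-1) ^+ k * 'C(n, k)%:R *
             ((k%:Z - r)%:~R / q%:R) ^+ l)) //; last first.
  - by rewrite nE addnCA mulnS ltn_add2l addnC ltn_add2r.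
  - by rewrite nE addnCA leq_add2l leq_addr.
  rewrite -altsumZ -altsumD /altsum mulr_sumr; apply: eq_bigr => j _.
  have jM : (j <= M)%N by rewrite -ltnS.
  rewrite {1}nE binE // -nE -nE' gE //.
  have -> : ((r' + q * j)%N%:Z - r)%:~R / q%:R = j%:R - a%:~R :> rat.
    have qr0 : q%:R != 0 :> rat by rewrite pnatr_eq0 -lt0n.
    have -> : (r' + q * j)%N%:Z - r = (j%:Z - a) * q%:Z.
      by rewrite [X in _ - X]rE PoszD PoszM; ring.
    by rewrite rmorphM rmorphB /= -!pmulrn mulfK.
  by rewrite -/(f j); ring.
have C0 : 'C(n', r')%:R != 0 :> rat.
  by rewrite pnatr_eq0 -lt0n bin_gt0 nE' leq_addr.
have M0 : M`!%:R != 0 :> rat by rewrite pnatr_eq0 -lt0n fact_gt0.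
have N0 : ((n %/ q)`!)%:R != 0 :> rat by rewrite pnatr_eq0 -lt0n fact_gt0.
set h := altsum M (fun j => g1 j * f j) / M`!%:R in hZ.
set d := (-1) ^+ r'.
set T := _ * _.
(* ['C(n', r')] cancels; [1 + p w] is ['C(n, n')] times the factorial of [M] over that of [n %/ q],
   and the last factor is the alternating sum over the factorial of [M]. *)
have -> : T = d * (1 + p%:R * w) * ((-1) ^+ l + p%:R * (y + z + h)).
  rewrite -wE -nE'.
  have -> : (-1) ^+ l + p%:R * (y + z + h) =
            (altsum M f + p%:R * altsum M (fun j => g1 j * f j)) / M`!%:R.
    rewrite mulrDl zE yE /h; ring.
  rewrite /T natrM; field.
  by rewrite M0 N0 C0.
(* Subtracting [d (-1) ^ l] from the product leaves [p] times this number. *)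
exists (d * (w * ((-1) ^+ l + p%:R * (y + z + h)) + (y + z + h))); last first.
  by rewrite exprD -/d; ring.
apply: Zloc_in_Zp => //.
have dZ : d \in Zloc p by rewrite rpredX // rpredN rpred1.
have lZ : (-1) ^+ l \in Zloc p by rewrite rpredX // rpredN rpred1.
have tZ : y + z + h \in Zloc p by rewrite !rpredD.
by rewrite rpredM // rpredD // rpredM // rpredD // rpredM // rpred_nat.
Qed.
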